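(* For integers $n,m\ge0$, variables $y_1,\dots,y_n$, and a partition $\lambda$ with at most $n$ parts, \[ s_\lambda(m+y_1,\dots,m+y_n)=\sum_{\mu\subset\lambda}|\mathrm{LHT}_{n,m}(\lambda/\mu)|\,s_\mu(y_1,\dots,y_n), \] where the sum is over all partitions $\mu$ contained in $\lambda$.
   Context: $s_\lambda(z_1,\dots,z_n)$ denotes the Schur polynomial in $n$ variables. $\mathbb N=\{0,1,2,\dots\}$. A partition $\lambda$ is identified with its Young diagram $\{(i,j):1\le i\le \ell(\lambda),\,1\le j\le\lambda_i\}$, where $\ell(\lambda)$ is the number of (positive) parts; $\mu\subset\lambda$ means containment of diagrams and $\lambda/\mu$ is the set difference. The content of a cell is $c(i,j)=j-i$. An $n$-lecture hall tableau of shape $\lambda/\mu$ is a map $L:\lambda/\mu\to\mathbb N$ such that \[ \frac{L(i,j)}{n+c(i,j)}\ge\frac{L(i,j+1)}{n+c(i,j+1)},\qquad \frac{L(i,j)}{n+c(i,j)}>\frac{L(i+1,j)}{n+c(i+1,j)} \] whenever the cells involved lie in $\lambda/\mu$. $\mathrm{LHT}_{n,m}(\lambda/\mu)$ is the set of such $L$ with $\lfloor L(i,j)/(n-i+j)\rfloor<m$ for every $(i,j)\in\lambda/\mu$. *)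

(* Defs.v *)
From mathcomp Require Import all_boot all_order all_algebra archimedean.
From mathcomp Require Export mpoly.

Set Implicit Arguments.
Unset Strict Implicit.
Unset Printing Implicit Defensive.

Import Order.TTheory GRing.Theory Num.Theory.

(* A partition is the sequence of its positive parts, in weakly decreasing
   order, so that [size la] is the number of parts. *)
Definition is_part (la : seq nat) : bool := sorted geq la && (0 \notin la).

(* Rows and columns are numbered from 0 (not 1): this shifts both coordinates
   of a cell by one and leaves contents unchanged. *)
Definition diagram (la : seq nat) : seq (nat * nat) :=
  [seq (i, j) | i <- iota 0 (size la), j <- iota 0 (nth 0 la i)].

Definition right_cell (c : nat * nat) : nat * nat := (c.1, c.2.+1).
Definition below_cell (c : nat * nat) : nat * nat := (c.1.+1, c.2).

Definition content (c : nat * nat) : int := (c.2%:Z - c.1%:Z)%R.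

Definition contains (la mu : seq nat) : bool :=
  all (mem (diagram la)) (diagram mu).

Definition skew (la mu : seq nat) : seq (nat * nat) :=
  [seq c <- diagram la | c \notin diagram mu].

Lemma mem_diagram la c :
  (c \in diagram la) = (c.1 < size la) && (c.2 < nth 0 la c.1).
Proof.
apply/allpairsPdep/andP => [[i [j [+ + ->]]]|[lt1 lt2]].
  by rewrite !mem_iota !add0n.
by exists c.1, c.2; rewrite !mem_iota !add0n lt1 lt2; case: c {lt1 lt2}.
Qed.

Fixpoint boxed_seqs (la : seq nat) : seq (seq nat) :=
  if la is p :: la' then
    [::] :: [seq q :: mu | q <- iota 1 p, mu <- boxed_seqs la']
  else [:: [::]].

(* The duplicate-free list of all partitions contained in [la]; see
   [mem_subparts] and [subparts_uniq]. *)
Definition subparts (la : seq nat) : seq (seq nat) :=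
  [seq mu <- boxed_seqs la | is_part mu && contains la mu].

Lemma boxed_seqsP la mu : 0 \notin mu -> contains la mu -> mu \in boxed_seqs la.
Proof.
elim: la mu => [|p la IH] [|q mu] //=.
  rewrite inE negb_or eq_sym -lt0n => /andP[q0 _] /allP /(_ (0, 0)).
  by rewrite !mem_diagram /= q0 => /(_ isT).
rewrite inE negb_or eq_sym -lt0n => /andP[q0 mu0] /allP sub; rewrite inE /=.
apply/allpairsPdep; exists q, mu; split => //.
  rewrite mem_iota q0 add1n ltnS /=.
  by have := sub (0, q.-1); rewrite inE !mem_diagram /= prednK // leqnn; apply.
apply: IH => //; apply/allP => -[i j]; rewrite mem_diagram => /= ij.
by have := sub (i.+1, j); rewrite inE !mem_diagram /=; apply.
Qed.

Lemma mem_subparts la mu :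
  (mu \in subparts la) = is_part mu && contains la mu.
Proof.
rewrite mem_filter; apply/andP/idP => [[]//|H]; split => //.
by case/andP: H => /andP[_ mu0]; apply: boxed_seqsP.
Qed.

Lemma subparts_uniq la : uniq (subparts la).
Proof.
apply: filter_uniq; elim: la => //= p la IH; apply/andP; split.
  by apply/allpairsPdep => -[? [? []]].
by apply: allpairs_uniq (iota_uniq _ _) IH _ => -[a b] [a' b'] _ _ /= [-> ->].
Qed.

Section LectureHall.
Local Open Scope ring_scope.

Definition lh_ratio (n : nat) (c : nat * nat) (k : nat) : rat :=
  k%:R / (n%:Z + content c)%:~R.

Definition is_LHT (n : nat) (la mu : seq nat)
    (L : seq_sub (skew la mu) -> nat) : bool :=
  [forall c, forall d,
    ((val d == right_cell (val c)) ==>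
       (lh_ratio n (val c) (L c) >= lh_ratio n (val d) (L d))) &&
    ((val d == below_cell (val c)) ==>
       (lh_ratio n (val c) (L c) > lh_ratio n (val d) (L d)))].

Definition is_bounded_LHT (n m : nat) (la mu : seq nat)
    (L : seq_sub (skew la mu) -> nat) : bool :=
  is_LHT n L && [forall c, Num.floor (lh_ratio n (val c) (L c)) < m%:Z].

(* The values are taken in a finite ordinal only so that the tableaux form a
   finite set; by [LHT_complete] this loses no tableau. *)
Definition LHT (n m : nat) (la mu : seq nat) :=
  [set L : {ffun seq_sub (skew la mu) -> 'I_(m * (n + head 0%N la))}
     | is_bounded_LHT n m (fun c => val (L c))].

Lemma lh_ratio_bound n m la c k :
  is_part la -> (size la <= n)%N -> c \in diagram la ->
  Num.floor (lh_ratio n c k) < m%:Z -> (k < m * (n + head 0%N la))%N.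
Proof.
case/andP=> la_sorted _ le_n; rewrite mem_diagram => /andP[lt1 lt2].
have c1n : (c.1 < n)%N by apply: leq_trans lt1 le_n.
have c2h : (c.2 < head 0%N la)%N.
  apply: leq_trans lt2 _; rewrite -nth0.
  have geq_trans : transitive geq by move=> x y z /= h1 h2; apply: leq_trans h2 h1.
  by apply: (sorted_leq_nth geq_trans leqnn 0 la_sorted); rewrite ?inE //;
    apply: leq_ltn_trans lt1.
have -> : lh_ratio n c k = k%:R / (n + c.2 - c.1)%:R.
  rewrite /lh_ratio /content addrA -PoszD subzn //.
  by apply: leq_trans (ltnW c1n) (leq_addr _ _).
have pos : (0 < n + c.2 - c.1)%N.
  by rewrite subn_gt0; apply: leq_trans c1n (leq_addr _ _).
rewrite real_floor_lt_int ?num_real // ltr_pdivrMr ?ltr0n //.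
rewrite -[(m%:Z)%:~R]/(m%:R) -natrM ltr_nat => /leq_trans; apply.
by rewrite leq_mul2l (leq_trans (leq_subr _ _)) ?orbT // leq_add2l ltnW.
Qed.

Lemma LHT_complete n m la mu (L : seq_sub (skew la mu) -> nat) :
  is_part la -> (size la <= n)%N -> is_bounded_LHT n m L ->
  exists2 T, T \in LHT n m la mu & forall c, L c = T c :> nat.
Proof.
move=> pla le_n bL; case/andP: (bL) => _ /forallP bd.
have lt c : (L c < m * (n + head 0%N la))%N.
  apply: lh_ratio_bound (bd c) => //.
  by have := valP c; rewrite mem_filter => /andP[].
exists [ffun c => Ordinal (lt c)] => [|c]; last by rewrite ffunE.
rewrite inE; case/andP: bL => /forallP bL _; apply/andP; split.
  apply/forallP => c; apply/forallP => d; have /forallP/(_ d) := bL c.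
  by rewrite !ffunE.
by apply/forallP => c; rewrite ffunE.
Qed.

End LectureHall.

Section Schur.
Local Open Scope ring_scope.

Definition is_SSYT (n : nat) (la : seq nat)
    (T : {ffun seq_sub (diagram la) -> 'I_n}) : bool :=
  [forall c, forall d,
    ((val d == right_cell (val c)) ==> (T c <= T d)%N) &&
    ((val d == below_cell (val c)) ==> (T c < T d)%N)].

Definition schur (n : nat) (la : seq nat) : {mpoly int[n]} :=
  \sum_(T : {ffun seq_sub (diagram la) -> 'I_n} | is_SSYT T) \prod_c 'X_(T c).

End Schur.

(* Main.v *)
Require Import Defs.
From mathcomp Require Import all_boot all_algebra.
From mathcomp Require Import all_order archimedean perm zify ring.
Import GRing.Theory.
Import Order.TTheory Num.Theory.
Local Open Scope ring_scope.

(** A partition la with at most n parts is encoded by the strictly decreasing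
    numbers l_i = la_i + (n - 1 - i), and a cell (i, j) by its row i and its
    position p = j + (n - 1 - i).  Then n + content = p + 1, and removing a
    horizontal strip from la amounts to lowering each l_i to some l'_i that
    stays above l_(i+1).

    The proof rests on one determinantal principle.  For a flag k and a weight
    w, let [strip_op k w] send a family phi to the family whose l-th term is the
    sum of w^(l - q) phi_q over q = l and over k <= q <= l.  Apply it in every
    column of the matrix phi_j(l_i).  Subtracting from each row a multiple of the
    next one cancels the terms with q <= l_(i+1), so by multilinearity the
    determinant becomes a sum over the l' obtained from l by removing a
    horizontal strip with positions at least k ([det_strip_op]).  Iterating, the
    strips removed at times 0, 1, 2, ... form a filling of a skew shape by their
    removal times: rows decrease weakly, columns decrease strictly, and a cell of
    value t has position at least the flag of time t ([window_sum_chain]).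
    This gives [det_fill_sum]: the determinant of the iterated operator is the
    sum, over mu inside la, of the weighted number of fillings of la/mu times
    the determinant of phi_j at the numbers attached to mu.

    The principle is used twice.

    With no flags and n steps weighted by the variables, the fillings of la are
    the semistandard tableaux read backwards.  Let phi_j be the coefficients of
    the product of the 1 - x_i t over i different from j.  The iterated operator
    then gives the powers of x_j, and phi_j vanishes from index n on, so that
    only the empty mu contributes: the Schur polynomial times the alternant of the
    empty partition is the alternant of la ([schur_bialternant]).

    With all weights 1 and m * K steps of flags 0, ..., K - 1 repeated m times,
    where K exceeds every position, K consecutive steps turn the powers of z into
    the powers of z + 1; the iterated operator gives the powers of m + x_j
    ([chain_op_shift]).  The fillings are the lecture hall tableaux: a value
    L = q (p + 1) + r with r <= p at position p corresponds to the step q K + r.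
    This turns the comparison of the ratios L / (p + 1) into that of the
    steps, the bound on the floors into q < m, and r <= p is the flag condition
    ([card_LHT]).  Hence the alternant of la at m + x is the sum of the
    |LHT(la/mu)| times the alternant of mu at x.  For la empty this says that the
    alternant of the empty partition is invariant under the shift; it is a
    Vandermonde determinant, so nonzero, and dividing by it, in the
    bialternant formula taken at m + x, gives the theorem. *)

(** * Determinants under the removal of a strip *)

Set Implicit Arguments.
Unset Strict Implicit.
Unset Printing Implicit Defensive.

Section StripDeterminant.
Variables (R : comNzRingType) (n : nat).

Lemma det_sum_rows (T : finType) (Q : 'I_n -> pred T) (a : 'I_n -> T -> R)
    (phi : T -> 'I_n -> R) :
  \det (\matrix_(i, j) \sum_(q | Q i q) a i q * phi q j) =
  \sum_(f : {ffun 'I_n -> T} | f \in family Q)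
    (\prod_i a i (f i)) * \det (\matrix_(i, j) phi (f i) j).
Proof.
rewrite /determinant.
under [RHS]eq_bigr do rewrite mulr_sumr.
rewrite exchange_big /=; apply: eq_bigr => s _.
under eq_bigr do rewrite mxE.
rewrite bigA_distr_big_dep mulr_sumr; apply: eq_bigr => f _.
rewrite big_split /= mulrCA; congr (_ * (_ * _)).
by apply: eq_bigr => i _; rewrite mxE.
Qed.

(** The matrix of the row operation is unitriangular. *)
Lemma det_sub_next_row (M : 'M[R]_n) (c : 'I_n -> 'I_n -> R) :
  \det (\matrix_(i, j)
    (M i j - \sum_(k : 'I_n | k == i.+1 :> nat) c i k * M k j)) = \det M.
Proof.
pose U : 'M[R]_n :=
  \matrix_(i, k) ((i == k)%:R - (k == i.+1 :> nat)%:R * c i k).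
have detU : \det U = 1.
  rewrite -det_tr det_trig.
    by rewrite big1 // => i _; rewrite !mxE eqxx eqn_leq ltnn andbF mul0r subr0.
  apply/is_trig_mxP => i k ltik; rewrite !mxE -val_eqE /=.
  by rewrite gtn_eqF // ltn_eqF ?mul0r ?subr0 // ltnS ltnW.
rewrite -[RHS]mul1r -detU -det_mulmx; congr (\det _).
apply/matrixP => i j; rewrite !mxE.
under [RHS]eq_bigr do rewrite mxE mulrBl.
rewrite sumrB; congr (_ - _).
  rewrite (bigD1 i) //= eqxx mul1r big1 ?addr0 // => k /negPf.
  by rewrite eq_sym => ->; rewrite mul0r.
rewrite big_mkcond; apply: eq_bigr => k _.
by case: eqP; rewrite ?mul1r ?mul0r.
Qed.

(** The terms with q < l are subject to the flag k, the term q = l is not: a row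
    may always be left untouched. *)
Definition strip_op (k : nat) (w : R) (phi : nat -> R) (l : nat) : R :=
  \sum_(q < l.+1 | (q == l :> nat) || (k <= q)%N) w ^+ (l - q) * phi q.

(** Lowering l to l' removes a horizontal strip all of whose cells have position
    at least k. *)
Definition strip (b k : nat) (l l' : {ffun 'I_n -> 'I_b}) : bool :=
  [forall i, [&& (l' i <= l i)%N, (l' i == l i) || (k <= l' i)%N &
     [forall i' : 'I_n, (i' == i.+1 :> nat) ==> (l i' < l' i)%N]]].

Definition strict (b : nat) (l : {ffun 'I_n -> 'I_b}) : bool :=
  [forall i : 'I_n, forall i' : 'I_n, (i' == i.+1 :> nat) ==> (l i' < l i)%N].

Lemma strip_opE b k w phi (l : 'I_b) :
  strip_op k w phi l =
  \sum_(q < b | (q <= l)%N && ((q == l) || (k <= q)%N)) w ^+ (l - q) * phi q.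
Proof.
rewrite /strip_op (big_ord_widen_cond b (fun q => (q == l :> nat) || (k <= q)%N)
  (fun q => w ^+ (l - q) * phi q)) //.
by apply: eq_bigl => q; rewrite ltnS andbC.
Qed.

(** If k <= l_(i+1), the terms q <= l_(i+1) of row i are w^(l_i - l_(i+1)) times
    row i+1, and a row subtraction removes them; if l_(i+1) < k, the flag already
    excludes them. *)
Lemma det_strip_op b k w (phi : 'I_n -> nat -> R) (l : {ffun 'I_n -> 'I_b}) :
  strict l ->
  \det (\matrix_(i, j) strip_op k w (phi j) (l i)) =
  \sum_(l' | strip k l l')
    w ^+ (\sum_i (l i - l' i))%N * \det (\matrix_(i, j) phi j (l' i)).
Proof.
move=> /forallP l_strict.
pose Q (i : 'I_n) (q : 'I_b) := [&& (q <= l i)%N, (q == l i) || (k <= q)%N &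
     [forall i' : 'I_n, (i' == i.+1 :> nat) ==> (l i' < q)%N]].
transitivity (\det (\matrix_(i, j) \sum_(q | Q i q) w ^+ (l i - q) * phi j q)).
  (* when l i' < k the flag does the work: nothing is subtracted *)
  pose c (i i' : 'I_n) := if (k <= l i')%N then w ^+ (l i - l i') else 0.
  rewrite -(det_sub_next_row _ c); congr (\det _).
  apply/matrixP => i j; rewrite !mxE.
  have [i' i'E|noi] := pickP (fun i' : 'I_n => i' == i.+1 :> nat); last first.
    rewrite big_pred0 // subr0 strip_opE; apply: eq_bigl => q; rewrite /Q.
    suff -> : [forall i' : 'I_n, (i' == i.+1 :> nat) ==> (l i' < q)%N].
      by rewrite andbT.
    by apply/forallP => i'; rewrite noi.
  have li : (l i' < l i)%N by move: (l_strict i) => /forallP/(_ i')/implyP; apply.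
  have Qq q : [forall h : 'I_n, (h == i.+1 :> nat) ==> (l h < q)%N] = (l i' < q)%N.
    apply/forallP/idP => [/(_ i')|lt h]; first by rewrite i'E.
    apply/implyP => /eqP hE; suff -> : h = i' by [].
    by apply: val_inj; rewrite /= hE (eqP i'E).
  rewrite (big_pred1 i') => [|h]; last by rewrite /= -val_eqE /= (eqP i'E).
  rewrite mxE /c.
  rewrite !strip_opE (bigID (fun q : 'I_b => (l i' < q)%N)) /=.
  under [X in _ + X - _]eq_bigl => q do rewrite -leqNgt.
  set A := \sum_(_ | _) _; set B := \sum_(_ | _) _; set C := _ * _.
  have -> : B = C.
    rewrite {}/B {}/C; case: (leqP k (l i')) => kl.
      rewrite mulr_sumr; apply: eq_big => [q|q /andP[_ ql]].
        by rewrite -!val_eqE /=; lia.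
      by rewrite mulrA -exprD; congr (_ ^+ _ * _); lia.
    rewrite mul0r big_pred0 // => q; rewrite -!val_eqE /=; lia.
  rewrite addrK {}/A; apply: eq_bigl => q.
  by rewrite /Q Qq andbA.
rewrite det_sum_rows; apply: eq_big => [f|f _].
  by apply/familyP/forallP.
by rewrite -expr_sum.
Qed.

(** The step at time t, the first of the d steps, is applied last: it is the one
    that removes cells from the outermost shape. *)
Fixpoint chain_op (fl : nat -> nat) (w : nat -> R) d t (phi : nat -> R) : nat -> R :=
  if d is d'.+1 then strip_op (fl t) (w t) (chain_op fl w d' t.+1 phi) else phi.

Fixpoint chain_sum (fl : nat -> nat) (w : nat -> R) b d t
    (l m : {ffun 'I_n -> 'I_b}) : R :=
  if d is d'.+1 then
    \sum_(l' | strip (fl t) l l')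
      w t ^+ (\sum_i (l i - l' i))%N * chain_sum fl w d' t.+1 l' m
  else (l == m)%:R.

Lemma strip_strict b k (l l' : {ffun 'I_n -> 'I_b}) :
  strip k l l' -> strict l'.
Proof.
move=> /forallP s; apply/forallP => i; apply/forallP => i'; apply/implyP => i'E.
have /and3P[_ _ /forallP/(_ i')] := s i; rewrite i'E /=.
by apply: leq_ltn_trans; case/and3P: (s i').
Qed.

(** The expansion along one strip, iterated: the weighted chains of shapes from l
    to m do not depend on phi. *)
Lemma det_chain_op fl w b d t (phi : 'I_n -> nat -> R) (l : {ffun 'I_n -> 'I_b}) :
  strict l ->
  \det (\matrix_(i, j) chain_op fl w d t (phi j) (l i)) =
  \sum_m chain_sum fl w d t l m * \det (\matrix_(i, j) phi j (m i)).
Proof.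
elim: d t l => [|d IH] t l ls /=.
  rewrite (bigD1 l) //= eqxx mul1r big1 ?addr0 // => m /negPf.
  by rewrite eq_sym => ->; rewrite mul0r.
rewrite det_strip_op //.
under [RHS]eq_bigr do rewrite mulr_suml.
rewrite exchange_big /=; apply: eq_bigr => l' /strip_strict l's.
by rewrite IH // mulr_sumr; apply: eq_bigr => m _; rewrite mulrA.
Qed.

Lemma chain_sum_eq0 fl w b d t (l m : {ffun 'I_n -> 'I_b}) : strict l ->
  ~~ (strict m && [forall i, (m i <= l i)%N]) -> chain_sum fl w d t l m = 0.
Proof.
elim: d t l => [|d IH] t l ls mN /=.
  case: eqP mN => // <-; rewrite ls /=.
  by case/forallP => i.
rewrite big1 // => l' st; rewrite IH ?mulr0 ?(strip_strict st) //.
apply: contra mN => /andP[-> /forallP ml] /=; apply/forallP => i.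
by apply: leq_trans (ml i) _; case/and3P: (forallP st i).
Qed.
End StripDeterminant.

(** * Peeling the smallest entries off a filling *)

Section Peeling.
Variables (R : comNzRingType) (X : finType) (right below : rel X).
Variables (pos : X -> nat) (fl : nat -> nat) (w : nat -> R).

Definition filling (S : X -> nat) : bool :=
  [forall x, (fl (S x) <= pos x)%N &&
    [forall y, (right x y ==> (S y <= S x)%N) && (below x y ==> (S y < S x)%N)]].

Lemma eq_filling (S S' : X -> nat) : S =1 S' -> filling S -> filling S'.
Proof.
move=> E /forallP fS; apply/forallP => x; rewrite -E.
case/andP: (fS x) => -> /forallP fSx /=.
by apply/forallP => y; rewrite -!E.
Qed.

(** Fillings of a set D of cells by entries in t, ..., N.  They take the value 0
    off D, so that they are determined by their restriction to D while their type
    does not depend on D. *)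
Definition filling_from N (D : {set X}) (t : nat) (S : {ffun X -> 'I_N.+1}) :=
  [forall x, if x \in D then
     [&& (t <= S x)%N, (fl (S x) <= pos x)%N &
       [forall (y | y \in D),
          (right x y ==> (S y <= S x)%N) && (below x y ==> (S y < S x)%N)]]
   else S x == ord0].

(** The sets of cells of D that may carry the smallest entry t, the cells of
    D outside of A carrying larger ones. *)
Definition removable (D : {set X}) (t : nat) (A : {set X}) : bool :=
  [forall (x | x \in A), (fl t <= pos x)%N &&
     [forall (y | y \in D), (right x y ==> (y \in A)) && ~~ below x y]].

Lemma filling_fromP N (D : {set X}) t (S : {ffun X -> 'I_N.+1}) :
  reflect [/\ forall x, x \notin D -> S x = ord0,
    forall x, x \in D -> (t <= S x)%N,
    forall x, x \in D -> (fl (S x) <= pos x)%N,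
    forall x y, x \in D -> y \in D -> right x y -> (S y <= S x)%N &
    forall x y, x \in D -> y \in D -> below x y -> (S y < S x)%N]
  (filling_from D t S).
Proof.
apply: (iffP forallP) => [H|[H0 H1 H2 H3 H4] x].
  split=> x => [/negPf xD|xD|xD|y xD yD xy|y xD yD xy]; have := H x;
    rewrite xD; first by move/eqP.
  - by case/and3P.
  - by case/and3P.
  - by case/and3P=> _ _ /forall_inP/(_ y yD)/andP[/implyP/(_ xy)].
  - by case/and3P=> _ _ /forall_inP/(_ y yD)/andP[_ /implyP/(_ xy)].
case: ifPn => xD; last by rewrite H0.
rewrite H1 // H2 //=; apply/forall_inP => y yD.
by apply/andP; split; apply/implyP => xy; [apply: H3 | apply: H4].
Qed.

Lemma removableP (D : {set X}) t (A : {set X}) :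
  reflect [/\ forall x, x \in A -> (fl t <= pos x)%N,
    forall x y, x \in A -> y \in D -> right x y -> y \in A &
    forall x y, x \in A -> y \in D -> ~~ below x y]
  (removable D t A).
Proof.
apply: (iffP forall_inP) => [H|[H1 H2 H3] x xA].
  split=> x => [|y xA yD xy|y xA yD]; first by case/H/andP.
    by case/andP: (H x xA) => _ /forall_inP/(_ y yD)/andP[/implyP/(_ xy)].
  by case/andP: (H x xA) => _ /forall_inP/(_ y yD)/andP[].
rewrite H1 //=; apply/forall_inP => y yD; rewrite H3 // andbT.
by apply/implyP; apply: H2.
Qed.

Definition window_sum N (D : {set X}) (t : nat) : R :=
  \sum_(S : {ffun X -> 'I_N.+1} | filling_from D t S) \prod_(x in D) w (S x).

Lemma window_sum_end N D : window_sum N D N.+1 = (D == set0)%:R.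
Proof.
have [->|/set0Pn[x xD]] := eqVneq D set0.
  rewrite /window_sum (big_pred1 [ffun=> ord0]) ?big_set0 // => S.
  apply/filling_fromP/eqP => [[H0 _ _ _ _]|->].
    by apply/ffunP => x; rewrite H0 ?ffunE // inE.
  by split=> x; rewrite ?inE // ffunE.
rewrite /window_sum big_pred0 // => S; apply/negbTE/negP.
by move/filling_fromP => [_ /(_ x xD)]; rewrite leqNgt ltn_ord.
Qed.

(** Split the fillings by the set A of the cells with entry t.  What remains is a
    filling of D minus A by entries larger than t, and all conditions that involve
    a cell of A are conditions on A alone. *)
Lemma window_sum_peel N D t : (t <= N)%N ->
  window_sum N D t =
  \sum_(A : {set X} | (A \subset D) && removable D t A)
     w t ^+ #|A| * window_sum N (D :\: A) t.+1.
Proof.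
move=> tN; pose ot : 'I_N.+1 := inord t.
have otE : ot = t :> nat by rewrite inordK.
rewrite {1}/window_sum.
pose layer (S : {ffun X -> 'I_N.+1}) := [set x in D | S x == ot].
rewrite (partition_big layer (fun A => (A \subset D) && removable D t A)) /=;
  last first.
  move=> S /filling_fromP[H0 H1 H2 H3 H4]; apply/andP; split.
    by apply/subsetP => x; rewrite inE => /andP[].
  apply/removableP; split=> [x|x y|x y]; rewrite !inE => /andP[xD /eqP Sx].
  - by rewrite -otE -Sx; apply: H2.
  - move=> yD xy; rewrite yD /= -val_eqE /= otE eqn_leq H1 // andbT.
    by rewrite -otE -Sx H3.
  - move=> yD; apply/negP => /(H4 x y xD yD).
    by rewrite Sx otE ltnNge H1.
apply: eq_bigr => A /andP[/subsetP AD /removableP[A1 A2 A3]].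
rewrite /window_sum mulr_sumr.
rewrite (reindex_onto
  (fun S : {ffun X -> 'I_N.+1} => [ffun x => if x \in A then ot else S x])
  (fun S : {ffun X -> 'I_N.+1} => [ffun x => if x \in A then ord0 else S x])) /=;
  last first.
  move=> S /andP[_ /eqP lA]; apply/ffunP => x; rewrite !ffunE.
  case: ifPn => [|/negPf->] //.
  by rewrite -{1}lA inE => /andP[_ /eqP->].
apply: eq_big => S; last first.
  move=> _; rewrite (big_setID A) /= (setIidPr _); last exact/subsetP.
  rewrite (eq_bigr (fun=> w t)) => [|x xA]; last by rewrite ffunE xA otE.
  rewrite prodr_const; congr (_ * _); apply: eq_bigr => x.
  by rewrite inE ffunE => /andP[/negPf->].
apply/andP/filling_fromP => [[/andP[/filling_fromP[H0 H1 H2 H3 H4] /eqP lA] /eqP SE]|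
    [H0 H1 H2 H3 H4]].
  have {lA} lA x : x \in D -> x \notin A -> S x != ot.
    by move=> xD xA; move: (xA); rewrite -{1}lA inE xD ffunE (negPf xA).
  split=> x.
  - rewrite inE negb_and negbK -[S]SE !ffunE; case: ifPn => //= xA xD.
    by move: (H0 x xD); rewrite ffunE (negPf xA).
  - rewrite inE => /andP[xA xD]; rewrite ltn_neqAle.
    have := H1 x xD; rewrite ffunE (negPf xA) => ->; rewrite andbT eq_sym.
    by have := lA x xD xA; rewrite -val_eqE /= otE.
  - by rewrite inE => /andP[xA xD]; have := H2 x xD; rewrite ffunE (negPf xA).
  - move=> y; rewrite !inE => /andP[xA xD] /andP[yA yD] /(H3 x y xD yD).
    by rewrite !ffunE (negPf xA) (negPf yA).
  - move=> y; rewrite !inE => /andP[xA xD] /andP[yA yD] /(H4 x y xD yD).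
    by rewrite !ffunE (negPf xA) (negPf yA).
have inDA x : x \notin A -> x \in D -> x \in D :\: A by rewrite inE => -> ->.
split; last first.
  apply/eqP/ffunP => x; rewrite !ffunE.
  by have [xA|xA] := boolP (x \in A); rewrite // H0 // inE xA.
apply/andP; split; last first.
  apply/eqP/setP => x; rewrite inE ffunE.
  case: ifPn => xA; first by rewrite eqxx AD.
  case: (boolP (x \in D)) => //= xD; rewrite -val_eqE /= otE.
  by rewrite gtn_eqF // H1 // inDA.
apply/filling_fromP; split=> x.
- move=> xD; have xA : x \notin A by apply: contra xD; apply: AD.
  by rewrite ffunE (negPf xA) H0 // inE (negPf xD) andbF.
- move=> xD; rewrite ffunE; case: ifPn => xA; first by rewrite otE.
  by rewrite ltnW // H1 // inDA.
- move=> xD; rewrite ffunE; case: ifPn => xA; first by rewrite otE A1.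
  by rewrite H2 // inDA.
- move=> y xD yD xy; rewrite !ffunE.
  have [yA|yA] := boolP (y \in A); have [xA|xA] := boolP (x \in A) => //.
  + by rewrite otE ltnW // H1 // inDA.
  + by case/negP: yA; apply: A2 xy.
  + by rewrite H3 // inDA.
- move=> y xD yD xy; rewrite !ffunE.
  have [xA|xA] := boolP (x \in A); first by move: (A3 x y xA yD); rewrite xy.
  have [yA|yA] := boolP (y \in A); first by rewrite otE H1 // inDA.
  by rewrite H4 // inDA.
Qed.
End Peeling.

(** * Fillings of a skew shape as chains of strips *)

(** The cells X of the skew shape between m and top are used through their
    coordinates only; shapes l between the two are the sets [under l]. *)
Section SkewShape.
Variables (R : comNzRingType) (X : finType) (n b : nat).
Variables (row : X -> 'I_n) (pos : X -> nat) (fl : nat -> nat) (w : nat -> R).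
Variables m top : {ffun 'I_n -> 'I_b}.
Hypothesis m_strict : strict m.
Hypothesis coord_inj : forall x y, row x = row y -> pos x = pos y -> x = y.
Hypothesis coord_in : forall x, (m (row x) <= pos x < top (row x))%N.
Hypothesis coord_onto : forall i q, (m i <= q < top i)%N ->
  exists x, row x = i /\ pos x = q.

Definition right_of x y := (row y == row x) && (pos y == (pos x).+1).
Definition below_of x y := (row y == (row x).+1 :> nat) && (pos x == (pos y).+1).

Definition under (l : {ffun 'I_n -> 'I_b}) := [set x | (pos x < l (row x))%N].

Lemma card_under_row (l l' : {ffun 'I_n -> 'I_b}) i :
  (m i <= l' i <= l i)%N -> (l i <= top i)%N ->
  #|[set x in under l :\: under l' | row x == i]| = (l i - l' i)%N.
Proof.
case/andP=> ml' l'l lt; set A := [set x in _ | _].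
rewrite cardE -(size_map pos) -(size_iota (l' i) (l i - l' i)); apply: perm_size.
apply: uniq_perm; rewrite ?iota_uniq //.
  rewrite map_inj_in_uniq ?enum_uniq // => x y.
  rewrite !mem_enum !inE => /andP[_ /eqP rx] /andP[_ /eqP ry].
  by apply: coord_inj; rewrite rx ry.
move=> q; rewrite mem_iota subnKC //; apply/mapP/andP => [[x]|[l'q ql]].
  by rewrite mem_enum !inE -leqNgt => /andP[/andP[+ +] /eqP <-] ->.
have [|x [rx px]] := @coord_onto i q.
  by rewrite (leq_trans ml') //= (leq_trans ql).
by exists x => //; rewrite mem_enum !inE rx px eqxx ql -leqNgt l'q.
Qed.

Lemma card_under_diff (l l' : {ffun 'I_n -> 'I_b}) :
  (forall i, (m i <= l' i <= l i)%N) -> (forall i, (l i <= top i)%N) ->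
  #|under l :\: under l'| = (\sum_i (l i - l' i))%N.
Proof.
move=> ml l_top; rewrite -sum1_card (partition_big row predT) //=.
apply: eq_bigr => i _; rewrite -card_under_row // -sum1_card.
by apply: eq_bigl => x; rewrite inE.
Qed.

(** Since the row and column conditions are local, the interlacing l_(i+1) < l'_i
    is seen on one cell: if it failed, the removed cell of row i at position
    l_(i+1) would lie just above the last cell of row i+1 in l.  That cell is
    in the skew shape because m is strict. *)
Lemma removable_under t (l l' : {ffun 'I_n -> 'I_b}) :
  (forall i, (m i <= l' i <= l i)%N) -> (forall i, (l i <= top i)%N) ->
  strict l ->
  removable right_of below_of pos fl (under l) t (under l :\: under l')
  = strip (fl t) l l'.
Proof.
move=> ml lt ls; apply/removableP/forallP => [[H1 H2 H3] i|H].
  have /andP[mi li] := ml i; rewrite li /=; apply/andP; split.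
    have [//|ne] := eqVneq (l' i) (l i); rewrite /=.
    have lti : (l' i < l i)%N by rewrite ltn_neqAle ne.
    have [|x [rx px]] := @coord_onto i (l' i).
      by rewrite mi (leq_trans lti).
    by rewrite -px; apply: H1; rewrite !inE rx px lti ltnn.
  apply/forallP => i'; apply/implyP => i'E; rewrite ltnNge; apply/negP => le.
  have lti : (l i' < l i)%N.
    by move: ls => /forallP/(_ i)/forallP/(_ i'); rewrite i'E.
  have mlt : (m i' < m i)%N.
    by move: m_strict => /forallP/(_ i)/forallP/(_ i'); rewrite i'E.
  have [|x [rx px]] := @coord_onto i (l i').
    by rewrite (leq_trans mi) //= (leq_trans lti).
  have l0 : (0 < l i')%N by lia.
  have [|y [ry py]] := @coord_onto i' (l i').-1.
    by have := lt i'; lia.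
  suff: ~~ below_of x y by rewrite /below_of ry rx px py i'E prednK // eqxx.
  apply: H3.
  - by rewrite !inE rx px lti -leqNgt le.
  - by rewrite inE ry py prednK.
have P i := and3P (H i).
split=> x.
- rewrite !inE -leqNgt => /andP[l'x xl]; have [_ + _] := P (row x).
  case/orP => [/eqP E|]; first by move: l'x; rewrite E leqNgt xl.
  by move/leq_trans; apply.
- move=> y; rewrite !inE -!leqNgt => /andP[l'x xl] yl /andP[/eqP rE /eqP pE].
  by rewrite yl andbT rE pE ltnW.
- move=> y; rewrite !inE -!leqNgt => /andP[l'x xl] yl; apply/negP.
  move=> /andP[rE /eqP pE]; have [_ _ /forallP/(_ (row y))] := P (row x).
  rewrite rE /= => lt'; move: yl; rewrite ltnNge -ltnS -pE.
  by rewrite (leq_trans lt').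
Qed.

(** The inverse of l' |-> under l minus under l': row i of the new shape ends
    after the last cell that is not in A, or at m i if A takes the whole row. *)
Definition rest (l : {ffun 'I_n -> 'I_b}) (A : {set X}) : {ffun 'I_n -> 'I_b} :=
  [ffun i => insubd (l i)
     (maxn (m i) (\max_(x | (x \in under l :\: A) && (row x == i)) (pos x).+1))].

Lemma restE (l : {ffun 'I_n -> 'I_b}) (A : {set X}) i : (m i <= l i)%N ->
  rest l A i =
    maxn (m i) (\max_(x | (x \in under l :\: A) && (row x == i)) (pos x).+1)
    :> nat.
Proof.
move=> ml; rewrite ffunE val_insubd ifT // (leq_ltn_trans _ (ltn_ord (l i))) //.
rewrite geq_max ml /=; apply/bigmax_leqP => x.
by rewrite !inE => /andP[/andP[_ +] /eqP <-].
Qed.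

Lemma rest_bounds (l : {ffun 'I_n -> 'I_b}) (A : {set X}) i : (m i <= l i)%N ->
  (m i <= rest l A i <= l i)%N.
Proof.
move=> ml; rewrite restE // leq_maxl geq_max ml /=; apply/bigmax_leqP => x.
by rewrite !inE => /andP[/andP[_ +] /eqP <-].
Qed.

Lemma rest_under (l l' : {ffun 'I_n -> 'I_b}) :
  (forall i, (m i <= l' i <= l i)%N) -> (forall i, (l i <= top i)%N) ->
  rest l (under l :\: under l') = l'.
Proof.
move=> ml lt; apply/ffunP => i; apply: val_inj => /=.
have /andP[mi li] := ml i.
rewrite restE ?(leq_trans mi) //; apply/eqP; rewrite eqn_leq geq_max mi /=.
apply/andP; split.
  apply/bigmax_leqP => x; rewrite !inE -leqNgt => /andP[/andP[+ xl] /eqP ri].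
  by rewrite xl andbT -ltnNge ri.
have [E|ne] := eqVneq (m i) (l' i); first by rewrite leq_max E leqnn.
have lt' : (m i < l' i)%N by rewrite ltn_neqAle mi andbT.
have l0 : (0 < l' i)%N by apply: leq_ltn_trans lt'.
have [|x [rx px]] := @coord_onto i (l' i).-1.
  by have := lt i; lia.
rewrite leq_max; apply/orP; right.
apply: leq_trans (leq_bigmax_cond x _); first by rewrite px prednK.
by rewrite rx eqxx andbT !inE px rx prednK // leqnn /=; lia.
Qed.

(** A removable set contains with a cell all the cells to its right in l, so it
    consists of a final segment of each row. *)
Lemma under_rest t (l : {ffun 'I_n -> 'I_b}) (A : {set X}) :
  (forall i, (m i <= l i <= top i)%N) -> A \subset under l ->
  removable right_of below_of pos fl (under l) t A ->
  under l :\: under (rest l A) = A.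
Proof.
move=> ml /subsetP Al /removableP[_ A2 _].
have ml' i : (m i <= l i)%N by case/andP: (ml i).
apply/setP => x; rewrite !inE -leqNgt restE // geq_max.
have [xA|xA] := boolP (x \in A); last first.
  apply/negP => /andP[/andP[_ /bigmax_leqP/(_ x)]].
  by rewrite !inE xA eqxx andbT /= => le xl; move: (le xl); rewrite ltnn.
have xl := Al x xA; rewrite inE in xl; rewrite xl andbT.
case/andP: (coord_in x) => -> _ /=; apply/bigmax_leqP => y.
rewrite !inE => /andP[/andP[yA yl] /eqP ry]; rewrite ltnNge; apply/negP => le.
case/negP: yA.
have up d : forall z, row z = row x -> pos z = (pos x + d)%N ->
    (pos z < l (row x))%N -> z \in A.
  elim: d => [|d IH] z rz pz zl.
    by rewrite (@coord_inj z x) // pz addn0.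
  have [|z' [rz' pz']] := @coord_onto (row x) (pos x + d).
    have := coord_in x; have := ml (row x); lia.
  apply: (A2 z'); first by apply: IH => //; lia.
    by rewrite inE rz.
  by rewrite /right_of rz rz' pz pz' addnS !eqxx.
by apply: (up (pos y - pos x)%N) => //; [lia | rewrite -ry].
Qed.

Lemma window_sum_strip N t (l : {ffun 'I_n -> 'I_b}) :
  (t <= N)%N -> strict l -> (forall i, (m i <= l i <= top i)%N) ->
  window_sum right_of below_of pos fl w N (under l) t =
  \sum_(l' | strip (fl t) l l' && [forall i, (m i <= l' i)%N])
    w t ^+ (\sum_i (l i - l' i))%N *
    window_sum right_of below_of pos fl w N (under l') t.+1.
Proof.
move=> tN ls ml; rewrite window_sum_peel //.
have lt i : (l i <= top i)%N by case/andP: (ml i).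
have ml' i : (m i <= l i)%N by case/andP: (ml i).
rewrite (reindex_onto (fun l' => under l :\: under l') (rest l)) /=; last first.
  by move=> A /andP[Al rA]; apply: under_rest rA.
have bounds (l' : {ffun 'I_n -> 'I_b}) :
    strip (fl t) l l' -> [forall i, (m i <= l' i)%N] ->
    forall i, (m i <= l' i <= l i)%N.
  move=> st /forallP ml'' i; rewrite ml''.
  by case/and3P: (forallP st i).
apply: eq_big => l'; last first.
  move=> /andP[_ /eqP rE].
  have bl i : (m i <= l' i <= l i)%N by rewrite -rE rest_bounds.
  rewrite card_under_diff //; congr (_ * window_sum _ _ _ _ _ _ _ _).
  by apply/setP => x; rewrite !inE; have := bl (row x); lia.
apply/andP/andP => [[/andP[_ rA] /eqP rE]|[st ml'']].
  have bl i : (m i <= l' i <= l i)%N by rewrite -rE rest_bounds.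
  rewrite -removable_under // rA; split=> //.
  by apply/forallP => i; case/andP: (bl i).
have bl := bounds l' st ml''.
rewrite rest_under // eqxx removable_under // st andbT; split=> //.
by apply/subsetP => x; rewrite inE => /andP[].
Qed.

(** The removal times of the successive strips are the entries of the filling. *)
Lemma window_sum_chain N d t (l : {ffun 'I_n -> 'I_b}) :
  (d + t = N.+1)%N -> strict l -> (forall i, (m i <= l i <= top i)%N) ->
  window_sum right_of below_of pos fl w N (under l) t = chain_sum fl w d t l m.
Proof.
elim: d t l => [|d IH] t l /= dt ls ml.
  move: dt; rewrite add0n => ->; rewrite window_sum_end; congr (nat_of_bool _)%:R.
  apply/eqP/eqP => [/setP u0|->].
    apply/ffunP => i; apply: val_inj; apply/eqP; rewrite eqn_leq /=.
    case/andP: (ml i) => -> lt; rewrite andbT leqNgt; apply/negP => lti.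
    have [|x [rx px]] := @coord_onto i (m i); first by rewrite leqnn (leq_trans lti).
    by have := u0 x; rewrite !inE rx px lti.
  apply/setP => x; rewrite !inE ltnNge.
  by case/andP: (coord_in x) => ->.
rewrite window_sum_strip //; last by rewrite -ltnS -dt addSn ltnS leq_addl.
rewrite [RHS](bigID (fun l' : {ffun 'I_n -> 'I_b} => [forall i, (m i <= l' i)%N])) /=.
rewrite [X in _ + X]big1 ?addr0 => [|l' /andP[st mN]]; last first.
  by rewrite chain_sum_eq0 ?mulr0 ?(strip_strict st) // negb_and mN orbT.
apply: eq_bigr => l' /andP[st /forallP ml']; rewrite IH ?(strip_strict st) //.
  by rewrite -dt addnS.
move=> i; rewrite ml' /=; case/and3P: (forallP st i) => le _ _.
by apply: leq_trans le _; case/andP: (ml i).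
Qed.

End SkewShape.

(** * Partitions and their strictly decreasing encodings *)

Lemma geq_trans : transitive geq.
Proof. by move=> x y z /= h1 h2; apply: leq_trans h2 h1. Qed.

Lemma mem_diagram_lt la c : (c \in diagram la) = (c.2 < nth 0%N la c.1)%N.
Proof.
rewrite mem_diagram; case: ltnP => //= h; by rewrite nth_default.
Qed.

Lemma mem_skew la mu c :
  (c \in Defs.skew la mu) = (nth 0%N mu c.1 <= c.2 < nth 0%N la c.1)%N.
Proof. by rewrite mem_filter !mem_diagram_lt -leqNgt. Qed.

Lemma containsP la mu :
  reflect (forall i, (nth 0%N mu i <= nth 0%N la i)%N) (contains la mu).
Proof.
apply: (iffP allP) => [sub i|le c]; last first.
  by rewrite inE !mem_diagram_lt => /leq_trans; apply.
case E: (nth 0%N mu i) => [//|v].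
by have := sub (i, v); rewrite inE !mem_diagram_lt /= E; apply.
Qed.

Lemma part_le la i j : is_part la -> (i <= j)%N ->
  (nth 0%N la j <= nth 0%N la i)%N.
Proof.
case/andP=> srt _ ij; case: (ltnP j (size la)) => jl; last by rewrite nth_default.
by apply: (sorted_leq_nth geq_trans leqnn 0%N srt); rewrite ?inE //;
  apply: leq_ltn_trans jl.
Qed.

Lemma part_size_le la mu : is_part mu ->
  (forall i, (nth 0%N mu i <= nth 0%N la i)%N) -> (size mu <= size la)%N.
Proof.
move=> /andP[_ mu0] le; rewrite leqNgt; apply/negP => lt.
have := le (size la); rewrite (nth_default _ (leqnn (size la))) leqn0 => /eqP E.
by case/negP: mu0; rewrite -E mem_nth.
Qed.

Lemma part_ext la mu : is_part la -> is_part mu ->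
  (forall i, nth 0%N la i = nth 0%N mu i) -> la = mu.
Proof.
move=> pl pm E; apply: (@eq_from_nth _ 0%N) => [|i _]; last exact: E.
by apply/eqP; rewrite eqn_leq !part_size_le // => i; rewrite E.
Qed.

Lemma nth_filter_pos s i : sorted geq s ->
  nth 0%N [seq q <- s | q != 0%N] i = nth 0%N s i.
Proof.
elim: s i => //= q s IH i srt; have srt' := path_sorted srt.
case: eqP => [q0|_] /=; last by case: i => //= i; apply: IH.
have z : forall j, nth 0%N s j = 0%N.
  move=> j; case: (ltnP j (size s)) => js; last by rewrite nth_default.
  have /allP/(_ _ (mem_nth 0%N js)) := order_path_min geq_trans srt.
  by rewrite q0 /= leqn0 => /eqP.
by rewrite IH // z; case: i => [|i] /=; rewrite ?q0 ?z.
Qed.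

Section Shapes.
Variable n : nat.

(** The beta numbers of la (first-column hook lengths, when la has n parts). *)
Definition beta (la : seq nat) (i : nat) : nat := (nth 0%N la i + (n.-1 - i))%N.

Definition beta_ffun (b : nat) (la : seq nat) : {ffun 'I_n -> 'I_b.+1} :=
  [ffun i : 'I_n => inord (beta la i)].

Lemma beta_ffunE b la (i : 'I_n) : (forall i, nth 0%N la i + n <= b)%N ->
  beta_ffun b la i = beta la i :> nat.
Proof.
move=> le; rewrite ffunE inordK // /beta ltnS.
have := le i; have := ltn_ord i; lia.
Qed.

Lemma strict_ge b (m : {ffun 'I_n -> 'I_b}) (i : 'I_n) : strict m ->
  (n.-1 - i <= m i)%N.
Proof.
move=> ms; move E: (n.-1 - i)%N => d.
elim: d i E => // d IH i E.
have lt : (i.+1 < n)%N by lia.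
apply: leq_ltn_trans (IH (Ordinal lt) _) _; first by rewrite /=; lia.
by move: ms => /forallP/(_ i)/forallP/(_ (Ordinal lt)); rewrite eqxx.
Qed.

Lemma strict_beta b la : is_part la -> (forall i, nth 0%N la i + n <= b)%N ->
  strict (beta_ffun b la).
Proof.
move=> pl le; apply/forallP => i; apply/forallP => j; apply/implyP => /eqP jE.
rewrite !beta_ffunE // /beta jE; have := part_le pl (leqnSn i).
have := ltn_ord j; lia.
Qed.

(** A strict m satisfies m_i >= n - 1 - i, so the differences are the parts of a
    partition padded with zeros. *)
Lemma beta_onto b la (m : {ffun 'I_n -> 'I_b.+1}) :
  is_part la -> (forall i, nth 0%N la i + n <= b)%N ->
  strict m -> (forall i, m i <= beta_ffun b la i)%N ->
  exists2 mu, mu \in subparts la & m = beta_ffun b mu.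
Proof.
move=> pl le ms ml.
pose s := [seq (m i - (n.-1 - i))%N | i <- enum 'I_n].
have nthE (i : 'I_n) : nth 0%N s i = (m i - (n.-1 - i))%N.
  by rewrite (nth_map i) ?size_enum_ord // nth_ord_enum.
have srt : sorted geq s.
  apply/(sortedP 0%N) => i; rewrite size_map size_enum_ord => ni.
  rewrite (nthE (Ordinal ni)) (nthE (Ordinal (ltnW ni))) /=.
  move: ms => /forallP/(_ (Ordinal (ltnW ni)))/forallP/(_ (Ordinal ni)).
  by rewrite eqxx /=; lia.
pose mu := [seq q <- s | q != 0%N].
have nmu i : nth 0%N mu i = nth 0%N s i by apply: nth_filter_pos.
have pmu : is_part mu.
  rewrite /is_part mem_filter eqxx andbT.
  exact: (sorted_filter geq_trans).
have cmu : contains la mu.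
  apply/containsP => i; rewrite nmu.
  case: (ltnP i n) => ni; last by rewrite nth_default // size_map size_enum_ord.
  have := ml (Ordinal ni); rewrite beta_ffunE // /beta /=.
  by rewrite (nthE (Ordinal ni)) /=; lia.
exists mu; first by rewrite mem_subparts pmu.
apply/ffunP => i; apply: val_inj; rewrite /= beta_ffunE => [|j].
  by rewrite /beta nmu nthE subnK // strict_ge.
by apply: leq_trans (le j); rewrite leq_add2r; apply/containsP.
Qed.

Lemma beta_ffun_inj b la mu : is_part la -> is_part mu ->
  (size la <= n)%N -> (size mu <= n)%N ->
  (forall i, nth 0%N la i + n <= b)%N -> (forall i, nth 0%N mu i + n <= b)%N ->
  beta_ffun b la = beta_ffun b mu -> la = mu.
Proof.
move=> pl pm sl sm lb mb E; apply: part_ext => // i.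
case: (ltnP i n) => ni; last by rewrite !nth_default // (leq_trans _ ni).
have /(congr1 val) := congr1 (fun f : {ffun _ -> _} => f (Ordinal ni)) E.
by rewrite /= !beta_ffunE // => /addIn.
Qed.

Definition right_cells (s : seq (nat * nat)) (x y : seq_sub s) :=
  val y == right_cell (val x).
Definition below_cells (s : seq (nat * nat)) (x y : seq_sub s) :=
  val y == below_cell (val x).
(** For a cell in one of the first n rows, its content plus n - 1. *)
Definition cell_pos (s : seq (nat * nat)) (x : seq_sub s) : nat :=
  ((val x).2 + (n.-1 - (val x).1))%N.

Lemma skew_row_lt la mu (c : seq_sub (Defs.skew la mu)) : (size la <= n)%N ->
  ((val c).1 < n)%N.
Proof.
apply: leq_trans; have := valP c; rewrite mem_skew => /andP[_ lt].
by rewrite ltnNge; apply/negP => le; rewrite nth_default in lt.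
Qed.

Lemma cell_pos_lt la mu (c : seq_sub (Defs.skew la mu)) :
  is_part la -> (size la <= n)%N -> (cell_pos c < n + head 0 la)%N.
Proof.
move=> pl sl; have := skew_row_lt c sl; have := part_le pl (leq0n (val c).1).
have /andP[_] : (nth 0 mu (val c).1 <= (val c).2 < nth 0 la (val c).1)%N.
  by rewrite -mem_skew; apply: valP.
by rewrite nth0 /cell_pos; lia.
Qed.

Section Sums.
Variable R : comNzRingType.

Definition fill_sum (N : nat) (fl : nat -> nat) (w : nat -> R) s : R :=
  \sum_(S : {ffun seq_sub s -> 'I_N} |
          filling (@right_cells s) (@below_cells s) (@cell_pos s) fl
            (fun x => S x)) \prod_x w (S x).

Lemma fill_sum_nil N fl w : fill_sum N fl w [::] = 1.
Proof.
have no (c : seq_sub ([::] : seq (nat * nat))) : False by case: c.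
rewrite /fill_sum (big_pred1 [ffun c => match no c with end]).
  by rewrite big1 // => c; case: (no c).
move=> S; apply/forallP/eqP => [_|_ c]; last by case: (no c).
by apply/ffunP => c; case: (no c).
Qed.

(** The coordinates (row, position) make the cells of la/mu the skew shape between
    the beta numbers of mu and those of la. *)
Lemma fill_sum_chain N fl w la mu b :
  is_part la -> is_part mu -> contains la mu -> (size la <= n)%N ->
  (forall i, nth 0%N la i + n <= b)%N ->
  fill_sum N fl w (Defs.skew la mu) =
  chain_sum fl w N 0 (beta_ffun b la) (beta_ffun b mu).
Proof.
move=> pl pm /containsP cm sl lb.
have sm : (size mu <= n)%N by apply: leq_trans (part_size_le pm cm) sl.
have mb i : (nth 0%N mu i + n <= b)%N by apply: leq_trans (lb i); rewrite leq_add2r.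
set s := Defs.skew la mu.
have mem_s c : (c \in s) = (nth 0%N mu c.1 <= c.2 < nth 0%N la c.1)%N.
  exact: mem_skew.
have row_n (x : seq_sub s) : ((val x).1 < n)%N by apply: skew_row_lt sl.
pose row (x : seq_sub s) := Ordinal (row_n x).
(* without entries there is no default value, but the claim is direct *)
case: N => [|N].
  rewrite /fill_sum /=.
  have [s0|sN] := eqVneq s [::]; last first.
    have cs : nth (0, 0)%N s 0 \in s by rewrite mem_nth // lt0n size_eq0.
    rewrite big1 => [|S]; last by have := ltn_ord (S (SeqSub cs)); rewrite ltn0.
    case: eqP => // /(beta_ffun_inj pl pm sl sm lb mb) E.
    by move: cs; rewrite mem_s E; lia.
  have no (x : seq_sub s) : False by case: x => c; rewrite s0.
  rewrite (_ : la = mu) ?eqxx.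
    rewrite (big_pred1 [ffun x => match no x with end]).
      by rewrite big1 // => x; case: (no x).
    move=> S; apply/forallP/eqP => [_|_ x]; last by case: (no x).
    by apply/ffunP => x; case: (no x).
  apply: part_ext => // i; apply/eqP; rewrite eqn_leq cm andbT leqNgt.
  by apply/negP => lt; have := mem_s (i, nth 0%N mu i); rewrite s0 /= leqnn lt.
transitivity (window_sum (right_of row (@cell_pos s))
    (below_of row (@cell_pos s)) (@cell_pos s) fl w N
    (under row (@cell_pos s) (beta_ffun b la)) 0).
  have uT : under row (@cell_pos s) (beta_ffun b la) = setT.
    apply/setP => x; rewrite !inE beta_ffunE // /beta /cell_pos /= ltn_add2r.
    by have := valP x; rewrite mem_s => /andP[].
  have rE x y : right_of row (@cell_pos s) x y = @right_cells s x y.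
    rewrite /right_of /right_cells /right_cell -val_eqE /= /cell_pos /=.
    move: (row_n x) (row_n y) => /=.
    case: (ssval x) => i j; case: (ssval y) => i' j' /= xn yn.
    by rewrite xpair_eqE; case: eqP => //= ->; rewrite -addSn eqn_add2r.
  have bE x y : below_of row (@cell_pos s) x y = @below_cells s x y.
    rewrite /below_of /below_cells /below_cell /= /cell_pos /=.
    move: (row_n x) (row_n y) => /=.
    case: (ssval x) => i j; case: (ssval y) => i' j' /= xn yn.
    rewrite xpair_eqE; case: eqP => //= i'E; lia.
  apply: eq_big => [S|S _]; last by apply: eq_bigl => x; rewrite uT inE.
  rewrite /filling_from uT; apply: eq_forallb => x; rewrite inE /=.
  by congr (_ && _); apply: eq_forallb => y; rewrite inE rE bE.
apply: (@window_sum_chain _ _ _ _ _ _ _ _ _ (beta_ffun b la)); rewrite ?addn0 ?strict_beta //.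
- move=> x y /(congr1 val) /= rE; rewrite /cell_pos rE => /addIn cE.
  by apply: val_inj; rewrite [LHS]surjective_pairing [RHS]surjective_pairing rE cE.
- move=> x; rewrite !beta_ffunE // /beta /cell_pos /row /=.
  by rewrite leq_add2r -addSn leq_add2r; have := valP x; rewrite mem_s.
- move=> i q; rewrite !beta_ffunE // /beta => /andP[q1 q2].
  have cs : (val i, q - (n.-1 - i))%N \in s by rewrite mem_s /=; lia.
  exists (SeqSub cs); split; first exact: val_inj.
  by rewrite /cell_pos /=; lia.
- by move=> i; rewrite leqnn !beta_ffunE // /beta leq_add2r cm.
Qed.

(** The chains that start at la end at the beta numbers of the partitions
    contained in la. *)
Lemma det_fill_sum N fl w la (phi : 'I_n -> nat -> R) :
  is_part la -> (size la <= n)%N ->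
  \det (\matrix_(i, j) chain_op fl w N 0 (phi j) (beta la i)) =
  \sum_(mu <- subparts la) fill_sum N fl w (Defs.skew la mu) *
     \det (\matrix_(i < n, j < n) phi j (beta mu i)).
Proof.
move=> pl sl; pose b := (n + head 0%N la)%N.
have lb i : (nth 0%N la i + n <= b)%N.
  by rewrite addnC leq_add2l -nth0 part_le.
have subP mu : mu \in subparts la -> [/\ is_part mu, contains la mu,
    (size mu <= n)%N & forall i, (nth 0%N mu i + n <= b)%N].
  rewrite mem_subparts => /andP[pm cm]; have /containsP le := cm.
  split=> // [|i]; first exact: leq_trans (part_size_le pm le) sl.
  by apply: leq_trans (lb i); rewrite leq_add2r.
have matE mu (psi : 'I_n -> nat -> R) : (forall i, nth 0%N mu i + n <= b)%N ->
    \matrix_(i, j) psi j (beta mu i) = \matrix_(i, j) psi j (beta_ffun b mu i).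
  by move=> mb; apply/matrixP => i j; rewrite !mxE beta_ffunE.
rewrite (matE la (fun j => chain_op fl w N 0 (phi j))) //.
rewrite det_chain_op ?strict_beta //.
pose F m := chain_sum fl w N 0 (beta_ffun b la) m *
  \det (\matrix_(i, j) phi j (m i)).
transitivity (\sum_(m <- map (beta_ffun b) (subparts la)) F m); last first.
  rewrite big_map !big_seq; apply: eq_bigr => mu /subP[pm cm sm mb].
  by rewrite /F -matE // -fill_sum_chain.
have u_beta : uniq (map (beta_ffun b) (subparts la)).
  rewrite map_inj_in_uniq ?subparts_uniq // => x y /subP[px _ sx xb] /subP[py _ sy yb].
  exact: beta_ffun_inj.
rewrite (big_uniq _ u_beta) [RHS]big_mkcond; apply: eq_bigr => m _ /=; case: ifPn => // mN.
rewrite chain_sum_eq0 ?mul0r ?strict_beta //; apply: contra mN.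
case/andP => ms /forallP ml; apply/mapP.
by have [mu mu_la ->] := beta_onto pl lb ms ml; exists mu.
Qed.
End Sums.
End Shapes.

(** * The operators on families indexed by integers *)

Section StripOp.
Variable R : comNzRingType.
Implicit Types (phi psi : nat -> R) (w : R).

Lemma strip_op_low k w phi l : (l <= k)%N -> strip_op k w phi l = phi l.
Proof.
move=> lk; rewrite /strip_op (big_pred1 ord_max) => [|q].
  by rewrite /= subnn expr0 mul1r.
by rewrite /= -val_eqE /=; have := ltn_ord q; lia.
Qed.

Lemma strip_opS k w phi l : (k <= l)%N ->
  strip_op k w phi l.+1 = w * strip_op k w phi l + phi l.+1.
Proof.
move=> kl; rewrite /strip_op big_mkcond big_ord_recr /= eqxx subnn expr0 mul1r.
congr (_ + _); rewrite mulr_sumr big_mkcond [RHS]big_mkcond /=.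
apply: eq_bigr => q _ /=; have ql := ltn_ord q.
have -> : (q == l.+1 :> nat) || (k <= q)%N = ((q == l :> nat) || (k <= q)%N) by lia.
by case: ifP => // _; rewrite mulrA -exprS subSn.
Qed.

Lemma eq_strip_op k w phi psi l : (forall q, (q <= l)%N -> phi q = psi q) ->
  strip_op k w phi l = strip_op k w psi l.
Proof. by move=> E; apply: eq_bigr => q _; rewrite E // -ltnS. Qed.

Lemma eq_chain_op fl (w : nat -> R) d t phi psi l : (forall q, (q <= l)%N -> phi q = psi q) ->
  chain_op fl w d t phi l = chain_op fl w d t psi l.
Proof.
elim: d t l => [|d IH] t l E /=; first exact: E.
by apply: eq_strip_op => q ql; apply: IH => r rq; apply: E; apply: leq_trans ql.
Qed.

Lemma chain_op_add fl (w : nat -> R) d e t phi l :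
  chain_op fl w (d + e) t phi l =
  chain_op fl w d t (chain_op fl w e (t + d) phi) l.
Proof.
elim: d t l => [|d IH] t l /=; first by rewrite addn0.
by apply: eq_strip_op => q _; rewrite IH addSnnS.
Qed.

(** On generating functions, [strip_op 0 w] is the division by 1 - w t, and
    [diff_op w] the multiplication by it. *)
Definition diff_op w psi (l : nat) : R :=
  if l is l'.+1 then psi l - w * psi l' else psi 0%N.

Lemma strip_op_diff w psi l : strip_op 0 w (diff_op w psi) l = psi l.
Proof.
elim: l => [|l IH]; first by rewrite strip_op_low.
by rewrite strip_opS // IH /= addrCA subrr addr0.
Qed.

Fixpoint chain_diff (w : nat -> R) d t psi : nat -> R :=
  if d is d'.+1 then chain_diff w d' t.+1 (diff_op (w t) psi) else psi.

Lemma chain_op_diff (w : nat -> R) d t psi l :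
  chain_op (fun=> 0%N) w d t (chain_diff w d t psi) l = psi l.
Proof.
elim: d t psi l => //= d IH t psi l; rewrite -[RHS](strip_op_diff (w t)).
by apply: eq_strip_op => q _; apply: IH.
Qed.

Lemma chain_diff_eq0 (w : nat -> R) d t psi s : (forall l, (s <= l)%N -> psi l = 0) ->
  forall l, (s + d <= l)%N -> chain_diff w d t psi l = 0.
Proof.
elim: d t psi s => [|d IH] t psi s z l /=; first by rewrite addn0; apply: z.
rewrite -addSnnS; apply: IH => -[//|q] sq /=.
by rewrite !z ?mulr0 ?subr0 // ltnW.
Qed.

(** A geometric family of ratio x is killed by the factor 1 - x t; every
    factor delays by one the index from which this is visible. *)
Lemma chain_diff_geometric (w : nat -> R) d t psi s (x : R) :
  (forall l, (s <= l)%N -> psi l.+1 = x * psi l) ->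
  (exists2 u, (t <= u < t + d)%N & w u = x) ->
  forall l, (s + d <= l)%N -> chain_diff w d t psi l = 0.
Proof.
elim: d t psi s => [|d IH] t psi s g [u tu wu] l /=; first by lia.
rewrite -addSnnS; have [E|ne] := eqVneq t u.
  by apply: chain_diff_eq0 => -[//|q] sq /=; rewrite E wu g ?subrr.
apply: IH; last by exists u => //; lia.
case=> [//|q] sq /=; rewrite !g // 1?ltnW //.
by rewrite mulrBr !(mulrCA x).
Qed.

(** The flag k interpolates between z^l (k beyond l) and (z + 1)^l (k = 0): this is
    the geometric sum z^k + sum over q in ]k, l] of z^(k+1) (z+1)^(q-k-1). *)
Lemma strip_op_flag k (z : R) l :
  strip_op k 1 (fun q => z ^+ minn k.+1 q * (z + 1) ^+ (q - k.+1)) l =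
  z ^+ minn k l * (z + 1) ^+ (l - k).
Proof.
case: (leqP l k) => lk.
  by rewrite strip_op_low // (minn_idPr (leqW lk)); congr (_ * _ ^+ _); lia.
rewrite -(subnKC (ltnW lk)); move: (l - k)%N => e {l lk}.
rewrite addKn; elim: e => [|e IH].
  by rewrite addn0 strip_op_low // (minn_idPr (leqnSn k)) subnS subnn.
rewrite addnS strip_opS ?leq_addr // IH mul1r.
rewrite (minn_idPl _) ?ltnS ?leq_addr // subSS addKn !exprS; ring.
Qed.

(** The last d steps of a block of K. *)
Lemma chain_op_block K q (z : R) d k l : (d + k = K)%N -> (l < K)%N ->
  chain_op (fun t => t %% K)%N (fun=> 1) d (q * K + k) (fun l => z ^+ l) l
  = z ^+ minn k l * (z + 1) ^+ (l - k).
Proof.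
elim: d k l => [|d IH] k l dk lK.
  rewrite /= -dk in lK *; rewrite (minn_idPr (ltnW lK)).
  by rewrite (_ : (l - k)%N = 0%N) ?expr0 ?mulr1 //; apply/eqP; rewrite subn_eq0 ltnW.
rewrite /= modnMDl modn_small; last by lia.
rewrite -strip_op_flag; apply: eq_strip_op => r rl.
by rewrite -addnS IH ?addnS // (leq_ltn_trans rl).
Qed.

Lemma chain_op_shift K m q (x : R) l : (l < K)%N ->
  chain_op (fun t => t %% K)%N (fun=> 1) (m * K) (q * K) (fun l => x ^+ l) l
  = (m%:R + x) ^+ l.
Proof.
elim: m q l => [|m IH] q l lK; first by rewrite /= add0r.
rewrite mulSn chain_op_add.
rewrite (eq_chain_op _ _ _ _ (psi := fun l => (m%:R + x) ^+ l)) => [|r rl]; last first.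
  by rewrite addnC -mulSn IH // (leq_ltn_trans rl).
have := @chain_op_block K q (m%:R + x) K 0 l (addn0 K) lK.
rewrite addn0 => ->; rewrite min0n mul1r subn0 -addrA (addrC x) addrA.
by rewrite -natr1.
Qed.
End StripOp.

(** * The bialternant formula *)

Section Bialternant.
Variables (R : comNzRingType) (n : nat).

Definition alternant (x : 'I_n -> R) (la : seq nat) : R :=
  \det (\matrix_(i < n, j < n) x j ^+ beta n la i).

(** The smallest entry of a filling is removed first, while rows of semistandard
    tableaux increase: the entry t stands for the variable n - 1 - t. *)
Definition rev_var (x : 'I_n -> R) (t : nat) : R :=
  oapp x 0 (insub (n - t.+1)%N).

Lemma rev_varE (x : 'I_n -> R) (i : 'I_n) : rev_var x (rev_ord i) = x i.
Proof.
rewrite /rev_var /= subnS subKn; last exact: ltn_ord.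
by rewrite valK.
Qed.

(** For phi with [chain_op] equal to the powers of x_j, [det_fill_sum] computes the
    alternant of la.  Only the empty mu contributes: otherwise mu_0 + n - 1 >= n
    and the first row of the determinant vanishes.  The constant left over is
    identified by taking la empty. *)
Lemma fill_sum_bialternant (x : 'I_n -> R) la :
  is_part la -> (size la <= n)%N ->
  fill_sum n n (fun=> 0%N) (rev_var x) (diagram la) * alternant x [::] =
  alternant x la.
Proof.
pose phi (j : 'I_n) := chain_diff (rev_var x) n 0 (fun l => x j ^+ l).
pose d0 := \det (\matrix_(i < n, j < n) phi j (beta n [::] i)).
have altE mu : is_part mu -> (size mu <= n)%N ->
    alternant x mu = fill_sum n n (fun=> 0%N) (rev_var x) (diagram mu) * d0.
  move=> pm sm; transitivity (\det (\matrix_(i < n, j < n)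
      chain_op (fun=> 0%N) (rev_var x) n 0 (phi j) (beta n mu i))).
    congr (\det _); apply/matrixP => i j; rewrite !mxE.
    by rewrite /phi chain_op_diff.
  rewrite det_fill_sum // (bigD1_seq [::]) ?subparts_uniq //=; last first.
    by rewrite mem_subparts.
  rewrite [X in _ + X]big_seq_cond [X in _ + X]big1 ?addr0.
    by rewrite /Defs.skew filter_predT.
  move=> nu /andP[]; rewrite mem_subparts => /andP[pn /containsP le] nun.
  have sn := leq_trans (part_size_le pn le) sm.
  have s0 : (0 < size nu)%N by rewrite lt0n size_eq0.
  have n0 : (0 < n)%N by apply: leq_trans sn.
  rewrite (expand_det_row _ (Ordinal n0)) big1 ?mulr0 // => j _.
  rewrite mxE /phi (chain_diff_geometric (s := 0) (x := x j)) ?mul0r //.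
  - by move=> l _; rewrite exprS.
  - exists (rev_ord j); last by rewrite rev_varE.
    by rewrite add0n ltn_ord.
  rewrite add0n /beta /= subn0.
  have : (0 < nth 0 nu 0)%N.
    rewrite lt0n; apply: contraL pn => /eqP E.
    by rewrite /is_part negb_and negbK -E mem_nth ?orbT.
  by lia.
move=> pl sl; rewrite !altE //; congr (_ * _).
by rewrite (_ : diagram [::] = [::]) // fill_sum_nil mul1r.
Qed.
End Bialternant.

(** Replace each entry T by n - 1 - T. *)
Lemma schur_fill_sum n la :
  schur n la = fill_sum n n (fun=> 0%N) (rev_var (fun i => 'X_i)) (diagram la)
  :> {mpoly int[n]}.
Proof.
rewrite /schur /fill_sum.
pose rv (T : {ffun seq_sub (diagram la) -> 'I_n}) := [ffun c => rev_ord (T c)].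
have rvK : involutive rv by move=> T; apply/ffunP => c; rewrite !ffunE rev_ordK.
rewrite (reindex_inj (inv_inj rvK)) /=; apply: eq_big => [T|T _]; last first.
  by apply: eq_bigr => c _; rewrite ffunE -[X in rev_var _ (nat_of_ord X)]rev_ordK rev_varE.
rewrite /is_SSYT /filling; apply: eq_forallb => c /=.
apply: eq_forallb => d; rewrite /right_cells /below_cells !ffunE /=.
have := ltn_ord (T c); have := ltn_ord (T d).
move: (nat_of_ord (T c)) (nat_of_ord (T d)) => p q.
by do 2!case: (_ == _) => /=; lia.
Qed.

Lemma schur_bialternant n la : is_part la -> (size la <= n)%N ->
  schur n la * alternant (fun i => 'X_i) [::] = alternant (fun i => 'X_i) la
  :> {mpoly int[n]}.
Proof. by move=> pl sl; rewrite schur_fill_sum fill_sum_bialternant. Qed.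

(** * Lecture hall tableaux as fillings *)

Section Encoding.
Variable K : nat.

(** At position p, the quotient of a by p + 1 is the floor in the definition of
    bounded tableaux; the pair (quotient, remainder) is stored in base K, which
    no longer depends on p. *)
Definition enc (p a : nat) : nat := (a %/ p.+1 * K + a %% p.+1)%N.
Definition dec (p s : nat) : nat := (s %/ K * p.+1 + s %% K)%N.

Lemma encK p a : (p < K)%N -> dec p (enc p a) = a.
Proof.
move=> pK; have K0 : (0 < K)%N by apply: leq_ltn_trans pK.
have lt : (a %% p.+1 < K)%N by apply: leq_trans (ltn_pmod _ _) pK.
rewrite /enc /dec divnMDl // (divn_small lt) addn0 modnMDl.
by rewrite (modn_small lt) -divn_eq.
Qed.

Lemma decK p s : (s %% K <= p)%N -> enc p (dec p s) = s.
Proof.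
move=> sp; rewrite /enc /dec divnMDl // (@divn_small _ p.+1 sp) addn0 modnMDl.
by rewrite (@modn_small _ p.+1 sp) -divn_eq.
Qed.

Lemma enc_modn p a : (p < K)%N -> (enc p a %% K <= p)%N.
Proof.
move=> pK; have K0 : (0 < K)%N by apply: leq_ltn_trans pK.
have lt : (a %% p.+1 < K)%N by apply: leq_trans (ltn_pmod _ _) pK.
by rewrite /enc modnMDl (modn_small lt) -ltnS ltn_pmod.
Qed.

Lemma enc_lt m p a : (p < K)%N -> (enc p a < m * K)%N = (a < m * p.+1)%N.
Proof.
move=> pK; have K0 : (0 < K)%N by apply: leq_ltn_trans pK.
have lt : (a %% p.+1 < K)%N by apply: leq_trans (ltn_pmod _ _) pK.
rewrite -ltn_divLR // -ltn_divLR //.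
by rewrite /enc divnMDl // (divn_small lt) addn0.
Qed.

(** For equal quotients, the inequality between the ratios says that
    r_b (p + 1) <= r_a (p + 2) with r_a <= p, and this means r_b <= r_a; distinct
    quotients decide both sides. *)
Lemma enc_row p a b : (p.+1 < K)%N ->
  (b * p.+1 <= a * p.+2)%N = (enc p.+1 b <= enc p a)%N.
Proof.
move=> pK; rewrite /enc {1}(divn_eq a p.+1) {1}(divn_eq b p.+2).
have := ltn_pmod a (ltn0Sn p); have := ltn_pmod b (ltn0Sn p.+1).
move: (a %/ p.+1)%N (a %% p.+1)%N (b %/ p.+2)%N (b %% p.+2)%N => qa ra qb rb rb_lt ra_lt.
apply/idP/idP; case: (ltngtP qa qb) => [lt|lt|->]; nia.
Qed.

(** Here r_b (p + 2) < r_a (p + 1) with r_b <= p is equivalent to r_b < r_a. *)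
Lemma enc_col p a b : (p.+1 < K)%N ->
  (b * p.+2 < a * p.+1)%N = (enc p b < enc p.+1 a)%N.
Proof.
move=> pK; rewrite /enc {1}(divn_eq a p.+2) {1}(divn_eq b p.+1).
have := ltn_pmod a (ltn0Sn p.+1); have := ltn_pmod b (ltn0Sn p).
move: (a %/ p.+2)%N (a %% p.+2)%N (b %/ p.+1)%N (b %% p.+1)%N => qa ra qb rb rb_lt ra_lt.
apply/idP/idP; case: (ltngtP qa qb) => [lt|lt|->]; nia.
Qed.
End Encoding.

Lemma lh_ratioE n c k : (c.1 < n)%N ->
  lh_ratio n c k = k%:R / (c.2 + (n.-1 - c.1)).+1%:R.
Proof.
move=> cn; rewrite /lh_ratio /content.
have -> : n%:Z + (c.2%:Z - c.1%:Z) = (c.2 + (n.-1 - c.1)).+1%:Z by lia.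
by rewrite -pmulrn.
Qed.

Lemma ler_lh_ratio n c d a b : (c.1 < n)%N -> (d.1 < n)%N ->
  (lh_ratio n d b <= lh_ratio n c a) =
  (b * (c.2 + (n.-1 - c.1)).+1 <= a * (d.2 + (n.-1 - d.1)).+1)%N.
Proof.
move=> cn dn; rewrite !lh_ratioE //.
by rewrite ler_pdivrMr ?ltr0n // mulrAC ler_pdivlMr ?ltr0n // -!natrM ler_nat.
Qed.

Lemma ltr_lh_ratio n c d a b : (c.1 < n)%N -> (d.1 < n)%N ->
  (lh_ratio n d b < lh_ratio n c a) =
  (b * (c.2 + (n.-1 - c.1)).+1 < a * (d.2 + (n.-1 - d.1)).+1)%N.
Proof. by move=> cn dn; rewrite !ltNge ler_lh_ratio // -ltnNge. Qed.

Lemma bounded_LHTE n m la mu (L : seq_sub (Defs.skew la mu) -> nat) :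
  is_part la -> (size la <= n)%N ->
  is_bounded_LHT n m L =
  [forall c, L c < m * (cell_pos n c).+1]%N &&
  filling (@right_cells (Defs.skew la mu)) (@below_cells _) (@cell_pos n _)
    (fun t => t %% (n + head 0 la))%N
    (fun c => enc (n + head 0 la) (cell_pos n c) (L c)).
Proof.
move=> pl sl; set K := (n + head 0 la)%N.
have row_n (c : seq_sub (Defs.skew la mu)) : ((val c).1 < n)%N.
  exact: skew_row_lt.
have pos_K (c : seq_sub (Defs.skew la mu)) : (cell_pos n c < K)%N.
  exact: cell_pos_lt.
rewrite /is_bounded_LHT andbC; congr (_ && _).
  apply: eq_forallb => c; rewrite lh_ratioE // real_floor_lt_int ?num_real //.
  by rewrite ltr_pdivrMr ?ltr0n // -[(m%:Z)%:~R]/(m%:R) -natrM ltr_nat.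
rewrite /is_LHT /filling; apply: eq_forallb => c; rewrite enc_modn //.
apply: eq_forallb => d; rewrite (ler_lh_ratio _ _ (row_n c) (row_n d)).
rewrite (ltr_lh_ratio _ _ (row_n c) (row_n d)).
rewrite -!/(cell_pos n _); have := row_n c; have := row_n d.
rewrite /right_cells /below_cells; move: (pos_K c) (pos_K d); rewrite /cell_pos.
case: (val c) (val d) => [i j] [i' j'] /= cK dK dn cn.
congr (_ && _); apply/implyb_id2l => /eqP[iE jE]; subst i' j'.
- by rewrite addSn; apply: enc_row; rewrite -addSn.
- have -> : (n.-1 - i = (n.-1 - i.+1).+1)%N by lia.
  by rewrite addnS; apply: enc_col; rewrite -addnS; lia.
Qed.

(** The flag condition, remainder at most the position, makes [dec] a right inverse
    of [enc] on the entries of a filling. *)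
Lemma card_LHT (R : comNzRingType) n m la mu :
  is_part la -> (size la <= n)%N ->
  #|LHT n m la mu|%:R =
  fill_sum n (m * (n + head 0 la)) (fun t => t %% (n + head 0 la))%N (fun=> 1)
    (Defs.skew la mu) :> R.
Proof.
move=> pl sl; rewrite /fill_sum.
rewrite [RHS](eq_bigr (fun=> 1)) => [|S _]; last by rewrite big1.
rewrite sumr_const; congr _%:R.
set K := (n + head 0 la)%N; set s := Defs.skew la mu.
pose f (L : {ffun seq_sub s -> 'I_(m * K)}) : {ffun seq_sub s -> 'I_(m * K)} :=
  [ffun c => insubd (L c) (enc K (cell_pos n c) (L c))].
pose g (S : {ffun seq_sub s -> 'I_(m * K)}) : {ffun seq_sub s -> 'I_(m * K)} :=
  [ffun c => insubd (S c) (dec K (cell_pos n c) (S c))].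
have pos_K (c : seq_sub s) : (cell_pos n c < K)%N by apply: cell_pos_lt.
have fE L c : L \in LHT n m la mu -> f L c = enc K (cell_pos n c) (L c) :> nat.
  rewrite inE bounded_LHTE // => /andP[/forallP bd _].
  by rewrite ffunE val_insubd enc_lt // bd.
have gE (S : {ffun seq_sub s -> 'I_(m * K)}) c : (S c %% K <= cell_pos n c)%N ->
    g S c = dec K (cell_pos n c) (S c) :> nat.
  move=> fl; rewrite ffunE val_insubd ifT //.
  apply: (@leq_trans (m * (cell_pos n c).+1)); last by rewrite leq_mul2l pos_K orbT.
  by rewrite -(enc_lt _ _ (pos_K c)) decK.
have fK : {in LHT n m la mu, cancel f g}.
  move=> L LL; apply/ffunP => c; apply: val_inj.
  by rewrite /= gE fE // ?encK // enc_modn.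
rewrite -(card_in_imset (can_in_inj fK)); apply: eq_card => S.
rewrite [RHS]/in_mem /=; apply/imsetP/idP => [[L LL ->]|fS].
  have := LL; rewrite inE bounded_LHTE // => /andP[_ fL].
  by apply: eq_filling fL => c; rewrite fE.
have flS c : (S c %% K <= cell_pos n c)%N by case/andP: (forallP fS c).
have encg c : enc K (cell_pos n c) (g S c) = S c by rewrite gE // decK.
have LL : g S \in LHT n m la mu.
  rewrite inE bounded_LHTE //; apply/andP; split.
    by apply/forallP => c; rewrite -(enc_lt _ _ (pos_K c)) encg.
  by apply: eq_filling fS => c; rewrite encg.
by exists (g S) => //; apply/ffunP => c; apply: val_inj; rewrite /= fE // encg.
Qed.

(** * Shifting the variables *)

Lemma alternant_shift (R : comNzRingType) n m la (x : 'I_n -> R) :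
  is_part la -> (size la <= n)%N ->
  alternant (fun i => m%:R + x i) la =
  \sum_(mu <- subparts la) #|LHT n m la mu|%:R * alternant x mu.
Proof.
move=> pl sl; set K := (n + head 0 la)%N.
under eq_bigr => mu _ do rewrite card_LHT //.
rewrite -[RHS](det_fill_sum _ _ _ (fun j l => x j ^+ l)) //; congr (\det _).
apply/matrixP => i j; rewrite !mxE -(@chain_op_shift _ K _ 0) //.
have := part_le pl (leq0n i); have := ltn_ord i.
by rewrite nth0 /beta /K; lia.
Qed.

(** The empty partition contains only itself, and its skew shape has exactly one
    tableau. *)
Lemma alternant_shift0 (R : comNzRingType) n m (x : 'I_n -> R) :
  alternant (fun i => m%:R + x i) [::] = alternant x [::].
Proof.
by rewrite alternant_shift // big_seq1 card_LHT // (_ : Defs.skew [::] [::] = [::]) // fill_sum_nil mul1r.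
Qed.

(** Up to the order of its rows, a Vandermonde matrix of distinct variables. *)
Lemma alternant0_neq0 n : alternant (fun i => 'X_i : {mpoly int[n]}) [::] != 0.
Proof.
pose V := Vandermonde n (\row_j ('X_j : {mpoly int[n]})).
have -> : alternant (fun i => 'X_i : {mpoly int[n]}) [::] =
    \det (row_perm (perm (@rev_ord_inj n)) V).
  congr (\det _); apply/matrixP => i j; rewrite !mxE permE /beta nth_nil /= add0n.
  by congr (_ ^+ _); have := ltn_ord i; lia.
rewrite row_permE det_mulmx det_perm det_Vandermonde mulf_neq0 ?signr_eq0 //.
apply/prodf_neq0 => i _; apply/prodf_neq0 => j ij; rewrite !mxE subr_eq0.
apply/eqP => /(congr1 (mcoeff U_(i))); rewrite !mcoeffXU eqxx.
by rewrite -val_eqE /= gtn_eqF.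
Qed.

Theorem theorem1p5 (n m : nat) (la : seq nat)
  (la_part : is_part la) (la_size : (size la <= n)%N) :
  comp_mpoly [tuple m%:R + 'X_i | i < n] (schur n la) =
  \sum_(mu <- subparts la) #|LHT n m la mu|%:R * schur n mu.
Proof.
set y := [tuple m%:R + 'X_i | i < n].
have altE mu : comp_mpoly y (alternant (fun i => 'X_i) mu) =
    alternant (fun i => m%:R + 'X_i : {mpoly int[n]}) mu.
  rewrite /alternant -det_map_mx; congr (\det _); apply/matrixP => i j.
  by rewrite !mxE rmorphXn /= comp_mpolyXU -tnth_nth tnth_mktuple.
(* by shift invariance, the alternant to divide by may be taken at m + y on the
   left and at y on the right *)
apply: (mulIf (alternant0_neq0 n)).
rewrite -{1}(alternant_shift0 m) -altE -rmorphM /= schur_bialternant //.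
rewrite altE alternant_shift // mulr_suml [LHS]big_seq [RHS]big_seq; apply: eq_bigr => mu.
rewrite mem_subparts => /andP[pm /containsP le].
by rewrite -mulrA schur_bialternant // (leq_trans (part_size_le pm le)).
Qed.
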